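(* Let $\Gamma$ be a conservative valued constraint language on a finite domain $D$ such that $G_\Gamma$ has no soft self-loop, and let $M_1,M_2$ be a partition of $M$ into two sets each of which is independent in $G_\Gamma$. Define binary operations $\sqcap,\sqcup$ on $D$ by $(\sqcap(x,y),\sqcup(x,y))=(x,y)$ if $(x,y)\in M_1$; $=(y,x)$ if $(x,y)\in M_2$; and $=(x,y)$ otherwise. Then $\langle\sqcap,\sqcup\rangle$ is a multimorphism of $\Gamma$.
   Context: A weighted relation of arity $r$ on $D$ is a map $D^r\to\mathbb{Q}\cup\{\infty\}$; a relation has values in $\{0,\infty\}$. $\mathrm{Feas}(\gamma)=\{\mathbf{x}:\gamma(\mathbf{x})<\infty\}$, $\mathrm{Opt}(\gamma)$ is the relation of tuples in $\mathrm{Feas}(\gamma)$ of minimum value. $\Gamma$ is conservative if it contains all unary weighted relations $D\to\{0,1\}$. $\mathcal{C}(\Gamma)$ is the smallest set of weighted relations on $D$ containing $\Gamma$, all unary weighted relations on $D$ and the binary equality relation on $D$, and closed under: $\mathrm{Feas}$ and $\mathrm{Opt}$; adding a unary weighted relation $\mu$ at a coordinate $i$ ($\gamma'(\mathbf{x})=\gamma(\mathbf{x})+\mu(x_i)$); minimisation at a coordinate; and join of binary $\gamma_1,\gamma_2$: $\gamma(x,y)=\min_{z\in D}(\gamma_1(u_1,v_1)+\gamma_2(u_2,v_2))$ with $\{u_1,v_1\}=\{x,z\}$, $\{u_2,v_2\}=\{y,z\}$ (either order). $G_\Gamma$ is the undirected graph (self-loops allowed) on vertices $(a,b)\in D^2$,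 $a\ne b$, with an edge $(a_1,b_1)-(a_2,b_2)$ iff there is a binary $\gamma\in\mathcal{C}(\Gamma)$ with $(a_1,b_2),(b_1,a_2)\in\mathrm{Feas}(\gamma)$ and $\gamma(a_1,b_2)+\gamma(b_1,a_2)<\gamma(a_1,a_2)+\gamma(b_1,b_2)$; the edge is soft if some such $\gamma$ also has at least one of $(a_1,a_2),(b_1,b_2)$ in $\mathrm{Feas}(\gamma)$. $M$ is the set of vertices of $G_\Gamma$ without a self-loop. A set of vertices is independent if no edge joins two of its vertices. Operations act on tuples componentwise. A list $\langle f_1,..,f_k\rangle$ of $k$-ary operations is a multimorphism of $\gamma$ if for all $\mathbf{x}^1,..,\mathbf{x}^k\in\mathrm{Feas}(\gamma)$ each $f_i(\mathbf{x}^1,..,\mathbf{x}^k)\in\mathrm{Feas}(\gamma)$ and $\sum_i\gamma(f_i(\mathbf{x}^1,..,\mathbf{x}^k))\le\sum_i\gamma(\mathbf{x}^i)$; it is a multimorphism of $\Gamma$ if it is one of every $\gamma\in\Gamma$. *)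

(* Defs.v *)
From HB Require Import structures.
From mathcomp Require Import all_boot all_order all_algebra.

Set Implicit Arguments.
Unset Strict Implicit.
Unset Printing Implicit Defensive.

Import Order.TTheory GRing.Theory Num.Theory.
Local Open Scope ring_scope.

(* The rationals with a point at infinity: [None] is infinity.  The additive
   monoid and the total order are declared as canonical structures so that
   [+], [\sum], [<=], [<] and [Order.min] are the library's. *)
Definition qinf : Type := option rat.
Definition qfin (q : rat) : qinf := Some q.
Definition infty : qinf := None.

HB.instance Definition _ := Choice.on qinf.

Definition qadd (u v : qinf) : qinf :=
  match u, v with
  | Some p, Some q => Some (p + q)
  | _, _ => None
  end.

Definition qle (u v : qinf) : bool :=
  match u, v with
  | _, None => true
  | None, Some _ => false
  | Some p, Some q => p <= q
  end.

Lemma qaddA : associative qadd.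
Proof. by move=> [p|] [q|] [s|] //=; rewrite addrA. Qed.

Lemma qaddC : commutative qadd.
Proof. by move=> [p|] [q|] //=; rewrite addrC. Qed.

Lemma qadd0 : left_id (qfin 0) qadd.
Proof. by move=> [p|] //=; rewrite add0r. Qed.

HB.instance Definition _ := GRing.isNmodule.Build qinf qaddA qaddC qadd0.

Lemma qle_refl : reflexive qle.
Proof. by move=> [p|] /=. Qed.

Lemma qle_anti : antisymmetric qle.
Proof. by move=> [p|] [q|] //= /le_anti ->. Qed.

Lemma qle_trans : transitive qle.
Proof. by move=> [p|] [q|] [s|] //=; apply: le_trans. Qed.

Lemma qle_total : total qle.
Proof. by move=> [p|] [q|] //=; apply: le_total. Qed.

HB.instance Definition _ :=
  Order.Le_isPOrder.Build ring_display qinf qle_refl qle_anti qle_trans.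
HB.instance Definition _ :=
  Order.POrder_isTotal.Build ring_display qinf qle_total.

Lemma qle_infty (u : qinf) : u <= infty.
Proof. by case: u. Qed.

HB.instance Definition _ := Order.hasTop.Build ring_display qinf qle_infty.

Lemma qmin_infty_l : left_id infty (@Order.min ring_display qinf).
Proof. by move=> u; apply/min_idPr/qle_infty. Qed.

Lemma qmin_infty_r : right_id infty (@Order.min ring_display qinf).
Proof. by move=> u; apply/min_idPl/qle_infty. Qed.

HB.instance Definition _ :=
  Monoid.isMonoidLaw.Build qinf infty (@Order.min ring_display qinf)
    qmin_infty_l qmin_infty_r.

Section WeightedRelations.
Variable D : finType.

Definition wrel (r : nat) := {ffun r.-tuple D -> qinf}.

Definition language := forall r : nat, wrel r -> Prop.

Definition conservative (Gamma : language) :=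
  forall mu : wrel 1,
    (forall x, mu x = qfin 0 \/ mu x = qfin 1) -> Gamma 1%N mu.

Definition feas r (gamma : wrel r) (x : r.-tuple D) : bool :=
  gamma x < infty.

Definition opt r (gamma : wrel r) (x : r.-tuple D) : bool :=
  feas gamma x && [forall y, gamma x <= gamma y].

Definition rel_of r (P : pred (r.-tuple D)) : wrel r :=
  [ffun x => if P x then qfin 0 else infty].

Definition eqrel : wrel 2 :=
  rel_of (fun x : 2.-tuple D => tnth x 0 == tnth x 1).

Definition add_unary r (gamma : wrel r) (mu : wrel 1) (i : 'I_r) : wrel r :=
  [ffun x => gamma x + mu [tuple tnth x i]].

(* [x] with [z] inserted so as to become the [i]-th coordinate *)
Definition insert r (i : 'I_r.+1) (z : D) (x : r.-tuple D) : r.+1.-tuple D :=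
  [tuple if unlift i j is Some k then tnth x k else z | j < r.+1].

Definition minimise r (gamma : wrel r.+1) (i : 'I_r.+1) : wrel r :=
  [ffun x => \big[Order.min/infty]_(z : D) gamma (insert i z x)].

Definition ordered_pair (b : bool) (u v : D) : 2.-tuple D :=
  if b then [tuple u; v] else [tuple v; u].

Definition join (b1 b2 : bool) (gamma1 gamma2 : wrel 2) : wrel 2 :=
  [ffun x => \big[Order.min/infty]_(z : D)
     (gamma1 (ordered_pair b1 (tnth x 0) z) +
      gamma2 (ordered_pair b2 (tnth x 1) z))].

Inductive closure (Gamma : language) : language :=
| closure_base r (gamma : wrel r) :
    Gamma r gamma -> closure Gamma gamma
| closure_unary (mu : wrel 1) : closure Gamma mu
| closure_eq : closure Gamma eqrel
| closure_feas r (gamma : wrel r) :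
    closure Gamma gamma -> closure Gamma (rel_of (feas gamma))
| closure_opt r (gamma : wrel r) :
    closure Gamma gamma -> closure Gamma (rel_of (opt gamma))
| closure_add_unary r (gamma : wrel r) (mu : wrel 1) (i : 'I_r) :
    closure Gamma gamma -> closure Gamma (add_unary gamma mu i)
| closure_minimise r (gamma : wrel r.+1) (i : 'I_r.+1) :
    closure Gamma gamma -> closure Gamma (minimise gamma i)
| closure_join (b1 b2 : bool) (gamma1 gamma2 : wrel 2) :
    closure Gamma gamma1 -> closure Gamma gamma2 ->
    closure Gamma (join b1 b2 gamma1 gamma2).

Definition vertex (p : D * D) : bool := p.1 != p.2.

Definition edge_witness (gamma : wrel 2) (p q : D * D) : bool :=
  [&& feas gamma [tuple p.1; q.2],
      feas gamma [tuple p.2; q.1] &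
      gamma [tuple p.1; q.2] + gamma [tuple p.2; q.1] <
      gamma [tuple p.1; q.1] + gamma [tuple p.2; q.2]].

(* Symmetric in [p] and [q], see [edge_sym] below. *)
Definition edge (Gamma : language) (p q : D * D) : Prop :=
  [/\ vertex p, vertex q &
      exists gamma : wrel 2, closure Gamma gamma /\ edge_witness gamma p q].

Definition soft_edge (Gamma : language) (p q : D * D) : Prop :=
  [/\ vertex p, vertex q &
      exists gamma : wrel 2,
        [/\ closure Gamma gamma, edge_witness gamma p q &
            feas gamma [tuple p.1; q.1] || feas gamma [tuple p.2; q.2]]].

Definition loopless (Gamma : language) (p : D * D) : Prop :=
  vertex p /\ ~ edge Gamma p p.

Definition independent (Gamma : language) (A : {set D * D}) : Prop :=
  forall p q, p \in A -> q \in A -> ~ edge Gamma p q.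

(* One of the two parts may be empty. *)
Definition bipartition (M : D * D -> Prop) (M1 M2 : {set D * D}) : Prop :=
  (forall p, M p <-> p \in M1 :|: M2) /\ [disjoint M1 & M2].

Definition operation (k : nat) := k.-tuple D -> D.

Definition apply_op k r (f : operation k) (xs : k.-tuple (r.-tuple D)) :
    r.-tuple D :=
  [tuple f [tuple tnth (tnth xs j) i | j < k] | i < r].

Definition multimorphism_of k (fs : k.-tuple (operation k)) r
    (gamma : wrel r) : Prop :=
  forall xs : k.-tuple (r.-tuple D),
    (forall i, feas gamma (tnth xs i)) ->
    (forall i, feas gamma (apply_op (tnth fs i) xs)) /\
    \sum_(i < k) gamma (apply_op (tnth fs i) xs) <=
    \sum_(i < k) gamma (tnth xs i).

Definition multimorphism k (fs : k.-tuple (operation k)) (Gamma : language) :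
    Prop :=
  forall r (gamma : wrel r), Gamma r gamma -> multimorphism_of fs gamma.

Definition binary_op (f : D -> D -> D) : operation 2 :=
  fun t => f (tnth t 0) (tnth t 1).

Definition meet_join (M1 M2 : {set D * D}) (x y : D) : D * D :=
  if (x, y) \in M1 then (x, y)
  else if (x, y) \in M2 then (y, x)
  else (x, y).

Definition sqcap (M1 M2 : {set D * D}) (x y : D) : D := (meet_join M1 M2 x y).1.
Definition sqcup (M1 M2 : {set D * D}) (x y : D) : D := (meet_join M1 M2 x y).2.

Lemma join_eqrelE (gamma : wrel 2) (a b : D) :
  join false true gamma eqrel [tuple a; b] = gamma [tuple b; a].
Proof.
rewrite ffunE (bigD1 b) //= big1 => [|z neq_zb].
  by rewrite qmin_infty_r ffunE /tnth /= (eqxx b) [LHS]addr0.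
rewrite ffunE /tnth /= eq_sym (negbTE neq_zb).
by case: (gamma _).
Qed.

Lemma edge_sym (Gamma : language) (p q : D * D) :
  edge Gamma p q -> edge Gamma q p.
Proof.
case=> vp vq [gamma [Cg /and3P [f1 f2 lt12]]]; split=> //.
exists (join false true gamma eqrel); split.
  by apply: closure_join => //; apply: closure_eq.
by rewrite /edge_witness /feas !join_eqrelE; apply/and3P; split=> //;
  rewrite addrC.
Qed.

End WeightedRelations.

(* Main.v *)
Require Import Defs.
From mathcomp Require Import all_boot all_order all_algebra.
From mathcomp Require Import lra.

(** A pair in [M2] has no edge to the reversal of a pair outside [M2]: for a pair
    in [M1] this is independence of [M2], and an edge into a pair with a
    self-loop would, by composing edges, produce a self-loop at the first pair.
    Given feasible [x] and [y], let [S] be the set of coordinates whose pair is in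
    [M2]; the operations exchange [x] and [y] on [S].  Every binary weighted
    relation obtained from [gamma] by restricting coordinates and minimising out
    all but one coordinate of [S] and one outside [S] satisfies the exchange
    inequality, and this two-coordinate condition propagates to all coordinates:
    first feasibility of the exchanged tuples, then the inequality, by induction on
    the number of coordinates where [x] and [y] differ. *)

Set Implicit Arguments.
Unset Strict Implicit.
Unset Printing Implicit Defensive.

Import Order.TTheory GRing.Theory Num.Theory.
Local Open Scope ring_scope.

(** * Arithmetic and order on the rationals with infinity *)

Lemma qleE (p q : rat) : (qfin p <= qfin q) = (p <= q).
Proof. by []. Qed.

Lemma qltE (p q : rat) : (qfin p < qfin q) = (p < q).
Proof. by rewrite !ltNge qleE. Qed.

Lemma qaddE (p q : rat) : qfin p + qfin q = qfin (p + q).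
Proof. by []. Qed.

Lemma qadd_inftyl (u : qinf) : infty + u = infty.
Proof. by []. Qed.

Lemma qadd_inftyr (u : qinf) : u + infty = infty.
Proof. by case: u. Qed.

Lemma qlt_inftyP (u : qinf) : reflect (exists q, u = qfin q) (u < infty).
Proof.
case: u => [q|]; first by left; exists q.
by right; case.
Qed.

Definition qfinE := (qaddE, qleE, qltE, qadd_inftyl, qadd_inftyr).

Lemma qadd_lt_infty (u v : qinf) : (u + v < infty) = (u < infty) && (v < infty).
Proof. by case: u v => [p|] [q|]. Qed.

Lemma qleD (u v u' v' : qinf) : u <= u' -> v <= v' -> u + v <= u' + v'.
Proof.
case: u v u' v' => [u|] [v|] [u'|] [v'|] //; rewrite ?qfinE //; exact: lerD.
Qed.

(** Add the two inequalities and cancel [z + w], which is legitimate because both terms are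
    finite. *)
Lemma qle_add_chain (x y u v z w : qinf) : z < infty -> w < infty ->
  u + w <= z + y -> z + v <= x + w -> u + v <= x + y.
Proof.
case/qlt_inftyP=> z' -> /qlt_inftyP[w' ->].
case: x y u v => [x|] [y|] [u|] [v|] //; rewrite ?qfinE //; lra.
Qed.

(** The shift [m] divides one strict inequality between sums into two; it becomes the unary weight
    that composes edges. *)
Lemma qseparate (p q : rat) (u v : qinf) : qfin p + qfin q < u + v ->
  exists m : rat, qfin p < u + qfin m /\ qfin q + qfin m < v.
Proof.
case: u v => [u|] [v|]; rewrite ?qfinE // => lt_pq.
(* Midpoint of the interval from [p - u] to [v - q]; an infinite [u] or [v] removes the
   corresponding bound. *)
- by exists ((p - u + (v - q)) / 2%:R); rewrite !qfinE; split; lra.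
- by exists (p - u + 1); rewrite !qfinE; split=> //; lra.
- by exists (v - q - 1); rewrite !qfinE; split=> //; lra.
- by exists 0.
Qed.

(** * Restriction and projection inside the closure *)

Section Closure.
Variables (D : finType) (Gamma : language D).

Local Notation C := (@Defs.closure D Gamma _).

(** The point [z0] excludes an empty domain, where the minimum is the default [infty] and has no
    minimiser. *)
Lemma bigmin_attained (F : D -> qinf) (z0 : D) :
  exists z, \big[Order.min/infty]_(z : D) F z = F z.
Proof.
rewrite (bigmin_eq_arg _ z0) // => [|z _]; last exact: qle_infty.
by eexists.
Qed.

(** Each [P i] becomes a unary relation with values zero and infinity, added one coordinate at a
    time. *)
Lemma restrict_closure r (gamma : wrel D r) (P : 'I_r -> pred D) : C gamma ->
  exists2 gamma', C gamma' &
    forall x, gamma' x = if [forall i, P i (tnth x i)] then gamma x else infty.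
Proof.
move=> Cg.
suff [g Cg' gE] : exists2 g, C g & forall x,
    g x = if all (fun i => P i (tnth x i)) (enum 'I_r) then gamma x else infty.
  exists g => // x; rewrite gE; congr (if _ then _ else _).
  apply/allP/forallP => [h i|h i _]; last exact: h.
  by apply: h; rewrite mem_enum.
elim: (enum _) => [|i s [g Cg' gE]]; first by exists gamma.
pose mu : wrel D 1 := rel_of (fun x : 1.-tuple D => P i (tnth x 0)).
exists (add_unary g mu i) => [|x /=]; first exact: closure_add_unary.
rewrite !ffunE gE; case: (P i _) => /=; last by rewrite qadd_inftyr.
by rewrite [LHS]addr0.
Qed.

Lemma tuple2E (z : 2.-tuple D) : z = [tuple tnth z 0; tnth z 1].
Proof.
apply: eq_from_tnth => i; rewrite [RHS](tnth_nth (tnth z 0)) /=.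
by case: i => [[|[|//]] lt_i] /=; congr (tnth z _); apply: val_inj.
Qed.

Lemma insert_lift r (k : 'I_r.+1) (z : D) (x : r.-tuple D) (i : 'I_r) :
  tnth (insert k z x) (lift k i) = tnth x i.
Proof. by rewrite tnth_mktuple liftK. Qed.

Lemma insert_split r (k : 'I_r.+1) (z : r.+1.-tuple D) :
  insert k (tnth z k) [tuple tnth z (lift k i) | i < r] = z.
Proof.
apply: eq_from_tnth => i; rewrite tnth_mktuple.
by case: unliftP => [i' ->|->] //; rewrite tnth_mktuple.
Qed.

(** Lower bound and attainment together say that [g] is the minimum of [gamma] over all coordinates
    other than [i] and [j]. *)
Definition projects r (gamma : wrel D r) (i j : 'I_r) (g : wrel D 2) : Prop :=
  (forall z, g [tuple tnth z i; tnth z j] <= gamma z) /\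
  (forall a b, exists z,
     [/\ tnth z i = a, tnth z j = b & g [tuple a; b] = gamma z]).

(** As long as the arity exceeds two, a coordinate [k] other than [i] and [j] can be minimised
    out. *)
Lemma project_closure r (gamma : wrel D r) (i j : 'I_r) : C gamma -> i != j ->
  exists2 g, C g & projects gamma i j g.
Proof.
elim: r gamma i j => [|r IHr] gamma i j Cg neq_ij; first by case: i neq_ij.
have [r_gt1|r_le1] := ltnP 1 r.
  have [k] : exists k, k \in ~: [set i; j].
    apply/set0Pn; rewrite -card_gt0 cardsCs setCK card_ord subn_gt0.
    by rewrite cards2 neq_ij.
  rewrite !inE negb_or => /andP[ki kj].
  have [i' def_i _] := unlift_some ki; have [j' def_j _] := unlift_some kj.
  have neq_ij' : i' != j' by apply: contraNneq neq_ij => e; rewrite def_i e -def_j.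
  have [g Cg' [g_le g_at]] := IHr _ i' j' (closure_minimise k Cg) neq_ij'.
  exists g => //; split=> [z|a b].
    have := g_le [tuple tnth z (lift k l) | l < r].
    rewrite !tnth_mktuple -def_i -def_j => /le_trans; apply.
    rewrite ffunE -[in leRHS](insert_split k z).
    exact: (bigmin_le _ (tnth z k) (fun c => gamma (insert k c _))).
  have [z [zi zj gE]] := g_at a b.
  have [c minE] := bigmin_attained (fun c => gamma (insert k c z)) a.
  exists (insert k c z); rewrite def_i def_j !insert_lift; split=> //.
  by rewrite gE ffunE minE.
case: r r_le1 gamma i j neq_ij Cg {IHr} => [|[|//]] _ gamma i j neq_ij Cg.
  by rewrite (ord1 i) (ord1 j) eqxx in neq_ij.
have [[-> ->]|[-> ->]] : (i = 0 /\ j = 1) \/ (i = 1 /\ j = 0).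
  case: i j neq_ij => [[|[|//]] ?] [[|[|//]] ?] //= _; [left | right];
    by split; apply: val_inj.
  exists gamma => //; split=> [z|a b]; first by rewrite -tuple2E.
  by exists [tuple a; b].
(* The two coordinates are in the wrong order; a join with equality transposes them. *)
exists (Defs.join false true gamma (Defs.eqrel D)).
  by apply: closure_join => //; apply: closure_eq.
split=> [z|a b]; first by rewrite join_eqrelE -tuple2E.
by exists [tuple b; a]; rewrite join_eqrelE.
Qed.

(** Attainment is restricted to feasible pairs, since an infinite value may come from a point
    outside the box. *)
Lemma project_box r (gamma : wrel D r) (P : 'I_r -> pred D) (i j : 'I_r) :
  C gamma -> i != j ->
  exists2 g, C g &
    (forall z, (forall k, P k (tnth z k)) ->
       g [tuple tnth z i; tnth z j] <= gamma z) /\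
    (forall a b, feas g [tuple a; b] -> exists z,
       [/\ forall k, P k (tnth z k), tnth z i = a, tnth z j = b
         & g [tuple a; b] = gamma z]).
Proof.
move=> Cg neq_ij; have [gP CgP gPE] := restrict_closure P Cg.
have [g Cg' [g_le g_at]] := project_closure CgP neq_ij.
exists g => //; split=> [z Pz|a b].
  by have := g_le z; rewrite gPE (introT forallP Pz).
have [z [zi zj gE]] := g_at a b; rewrite /feas gE gPE.
by case: forallP => // Pz _; exists z.
Qed.

(** * Reversal and composition of edges *)

Definition bar (p : D * D) : D * D := (p.2, p.1).

Lemma edge_bar p q : edge Gamma p q -> edge Gamma (bar p) (bar q).
Proof.
case=> vp vq [g [Cg /and3P[f1 f2 lt12]]].
split; try by rewrite /vertex eq_sym.
exists g; split=> //; rewrite /edge_witness /=; apply/and3P; split=> //.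
by rewrite addrC [ltRHS]addrC.
Qed.

Lemma edge_self_bar p : vertex p -> edge Gamma p (bar p).
Proof.
move=> vp; split=> //; first by rewrite /vertex eq_sym.
exists (Defs.eqrel D); split; first exact: closure_eq.
by rewrite /edge_witness /feas !ffunE /tnth /= !eqxx (negbTE vp).
Qed.

(* The weight [m] put on [q.1] makes both paths through [q] that realise
   [(p.1, r.1)] and [(p.2, r.2)] beat the mixed ones. *)
Lemma edge_comp p q r : edge Gamma p q -> edge Gamma q r -> edge Gamma p (bar r).
Proof.
case: p q r => [a1 b1] [a2 b2] [a3 b3] [vp vq [g1 [Cg1 w1]]] [_ vr [g2 [Cg2 w2]]].
split=> //; first by rewrite /vertex eq_sym.
case/and3P: w1 => /= /qlt_inftyP[al alE] /qlt_inftyP[be beE] lt1.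
case/and3P: w2 => /= /qlt_inftyP[be' beE'] /qlt_inftyP[al' alE'] lt2.
rewrite alE beE in lt1; rewrite alE' beE' in lt2.
have [m [lo hi]] : exists m : rat,
    qfin (al + al') < (g1 [tuple a1; a2] + g2 [tuple a2; a3]) + qfin m /\
    qfin (be + be') + qfin m < g1 [tuple b1; b2] + g2 [tuple b2; b3].
  apply: qseparate; move: lt1 lt2.
  case: (g1 [tuple a1; a2]) (g1 [tuple b1; b2]) (g2 [tuple a2; a3])
    (g2 [tuple b2; b3]) => [s|] [t|] [s'|] [t'|]; rewrite ?qfinE //; lra.
(* Infinity elsewhere leaves only [a2] and [b2] as middle values, so each entry of [g] has two
   candidate paths. *)
pose mu : wrel D 1 := [ffun x => if tnth x 0 == a2 then qfin m
                       else if tnth x 0 == b2 then qfin 0 else infty].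
pose g := Defs.join true false (add_unary g1 mu 1) g2.
pose path x y z := g1 [tuple x; z] + (if z == a2 then qfin m
  else if z == b2 then qfin 0 else infty) + g2 [tuple z; y].
have gE x y : g [tuple x; y] = \big[Order.min/infty]_z path x y z.
  by rewrite ffunE; apply: eq_bigr => z _; rewrite !ffunE.
have g_le x y z : g [tuple x; y] <= path x y z.
  by rewrite gE; exact: (bigmin_le _ z (path x y)).
have b2a2 : (b2 == a2) = false by rewrite eq_sym; apply/negbTE.
have leA := g_le a1 a3 b2; have leB := g_le b1 b3 a2.
rewrite /path b2a2 eqxx alE alE' !qfinE in leA.
rewrite /path eqxx beE beE' !qfinE in leB.
exists g; split; first by apply: closure_join => //; apply: closure_add_unary.
rewrite /edge_witness /feas /=; apply/and3P; split;
  try by apply: le_lt_trans leA _.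
  by apply: le_lt_trans leB _.
apply: (@le_lt_trans _ _ (qfin (al + 0 + al' + (be + m + be')))).
  move: leA leB; case: (g _) => [u|] //; case: (g _) => [v|] //.
  rewrite !qfinE; lra.
have g_at x y : g [tuple x; y] = infty \/
    g [tuple x; y] = g1 [tuple x; a2] + qfin m + g2 [tuple a2; y] \/
    g [tuple x; y] = g1 [tuple x; b2] + qfin 0 + g2 [tuple b2; y].
  rewrite gE; have [z ->] := bigmin_attained (path x y) a2; rewrite /path.
  case: (z =P a2) => [->|_]; first by right; left.
  case: (z =P b2) => [->|_]; first by right; right.
  by left; rewrite qadd_inftyr.
case: (g_at a1 b3) => [->|g13]; first by rewrite qadd_inftyl.
case: (g_at b1 a3) => [->|g31]; first by rewrite qadd_inftyr.
(* If the two mixed paths share their middle value, the bound [lo] or [hi] on [m] decides; otherwise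
   [lt1] or [lt2] does. *)
move: lt1 lt2 lo hi.
case: g13 => ->; case: g31 => ->; rewrite ?alE ?beE ?alE' ?beE';
case: (g1 [tuple a1; a2]) (g1 [tuple b1; b2]) (g2 [tuple a2; a3])
    (g2 [tuple b2; b3]) => [s|] [t|] [s'|] [t'|]; rewrite ?qfinE //; lra.
Qed.

(** * Exchanged tuples and compatibility *)

Definition mix r (S : pred 'I_r) (x y : r.-tuple D) : r.-tuple D :=
  [tuple if S i then tnth y i else tnth x i | i < r].

(* No edge joins [p] to [bar q], also when [p] or [q] is not a vertex. *)
Definition compat (p q : D * D) : Prop := forall g : wrel D 2, C g ->
  feas g [tuple p.1; q.1] -> feas g [tuple p.2; q.2] ->
  g [tuple p.2; q.1] + g [tuple p.1; q.2] <=
  g [tuple p.1; q.1] + g [tuple p.2; q.2].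

Lemma compat_bar p q : compat p q -> compat (bar p) (bar q).
Proof.
by move=> cpq g Cg f1 f2; rewrite addrC [leRHS]addrC; apply: cpq.
Qed.

Lemma compat_edge p q : (vertex p -> vertex q -> ~ edge Gamma p (bar q)) ->
  compat p q.
Proof.
case: p q => [a b] [c d] no_edge g Cg /= f1 f2.
have [eq_ab|neq_ab] := eqVneq a b; first by rewrite eq_ab.
have [eq_cd|neq_cd] := eqVneq c d; first by rewrite eq_cd addrC.
rewrite leNgt; apply/negP => lt12; apply: (no_edge neq_ab neq_cd).
split=> //; first by rewrite /vertex eq_sym.
exists g; split=> //; rewrite /edge_witness /= f1 f2 /=.
by rewrite [ltRHS]addrC.
Qed.

Definition compatible r (S : pred 'I_r) (x y : r.-tuple D) : Prop :=
  forall i j, S i -> ~~ S j ->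
    compat (tnth x i, tnth y i) (tnth x j, tnth y j).

(** The pairs to which the induction descends: every coordinate is either merged or kept, so
    compatibility is inherited and the distance cannot grow. *)
Definition subpair r (x' y' x y : r.-tuple D) : Prop :=
  forall k, tnth x' k = tnth y' k \/
    (tnth x' k = tnth x k /\ tnth y' k = tnth y k).

Definition distance r (x y : r.-tuple D) : nat :=
  #|[set k | tnth x k != tnth y k]|.

Lemma compatible_bar r (S : pred 'I_r) x y :
  compatible S x y -> compatible S y x.
Proof. by move=> cxy i j Si Sj; exact: (compat_bar (cxy i j Si Sj)). Qed.

Lemma compatible_subpair r (S : pred 'I_r) x' y' x y :
  subpair x' y' x y -> compatible S x y -> compatible S x' y'.
Proof.
move=> sub cxy i j Si Sj.
case: (sub i) => [->|[-> ->]]; first by move=> g _ _ _ /=.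
case: (sub j) => [->|[-> ->]]; last exact: cxy.
by move=> g _ _ _ /=; rewrite addrC.
Qed.

Lemma distance_subpair r (x' y' x y : r.-tuple D) k : subpair x' y' x y ->
  tnth x' k = tnth y' k -> tnth x k <> tnth y k ->
  (distance x' y' < distance x y)%N.
Proof.
move=> sub eq_k neq_k; apply/proper_card/properP; split.
  apply/subsetP => l; rewrite !inE.
  by case: (sub l) => [->|[-> ->]] //; rewrite eqxx.
by exists k; rewrite inE ?eq_k ?eqxx //; apply/eqP.
Qed.

(** * Feasibility of the exchanged tuples *)

Definition inbox r (x y z : r.-tuple D) : bool :=
  [forall k, (tnth z k == tnth x k) || (tnth z k == tnth y k)].

Lemma inboxP r (x y z : r.-tuple D) : inbox x y z ->
  forall k, tnth z k = tnth x k \/ tnth z k = tnth y k.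
Proof. by move=> /forallP box k; case/orP: (box k) => /eqP; [left | right]. Qed.

(* Induction on the set [K] of coordinates on which [z] has to agree with
   [mix S x y]: two solutions that each miss one coordinate of [K] are the two
   feasible corners of a binary relation in which [compat] supplies a third. *)
Lemma feas_mix_on r (gamma : wrel D r) (S : pred 'I_r) x y (K : {set 'I_r}) :
  C gamma -> compatible S x y -> feas gamma x -> feas gamma y ->
  exists z, [/\ feas gamma z, inbox x y z &
    forall k, k \in K -> tnth z k = tnth (mix S x y) k].
Proof.
move=> Cg cxy fx fy; move: {2}#|K| (leqnn #|K|) => n.
elim: n K => [|n IHn] K leK.
  exists x; split=> //; first by apply/forallP => k; rewrite eqxx.
  by move=> k; move: leK; rewrite leqn0 cards_eq0 => /eqP->; rewrite inE.
case: (pickP (fun i => (i \in K) && S i)) => [i /andP[Ki Si]|noS]; last first.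
  exists x; split=> //; first by apply/forallP => k; rewrite eqxx.
  by move=> k Kk; have := noS k; rewrite Kk /= tnth_mktuple => ->.
case: (pickP (fun j => (j \in K) && ~~ S j)) => [j /andP[Kj Sj]|allS]; last first.
  exists y; split=> //; first by apply/forallP => k; rewrite eqxx orbT.
  by move=> k Kk; have := allS k; rewrite Kk /= tnth_mktuple => /negbFE ->.
have leKD k : k \in K -> (#|K :\ k| <= n)%N.
  by move=> Kk; move: leK; rewrite (cardsD1 k) Kk.
have [z1 [f1 b1 m1]] := IHn _ (leKD _ Ki).
have [z2 [f2 b2 m2]] := IHn _ (leKD _ Kj).
have neq_ij : i != j by apply: contraNneq Sj => <-.
have m1j : tnth z1 j = tnth x j.
  by rewrite m1 ?tnth_mktuple ?(negbTE Sj) // !inE Kj eq_sym neq_ij.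
have m2i : tnth z2 i = tnth y i.
  by rewrite m2 ?tnth_mktuple ?Si // !inE Ki neq_ij.
have [z1i|z1i] := inboxP b1 i; last first.
  exists z1; split=> // k Kk; have [->|neq_k] := eqVneq k i.
    by rewrite tnth_mktuple Si.
  by rewrite m1 // !inE neq_k.
have [z2j|z2j] := inboxP b2 j.
  exists z2; split=> // k Kk; have [->|neq_k] := eqVneq k j.
    by rewrite tnth_mktuple (negbTE Sj).
  by rewrite m2 // !inE neq_k.
(* Besides the box, [P] pins the coordinates of [K] other than [i] and [j], where [z1] and [z2]
   already agree with the mix; the point found later is then right on all of [K]. *)
pose P k c := ((c == tnth x k) || (c == tnth y k)) &&
  ((k \in K :\ i :\ j) ==> (c == tnth (mix S x y) k)).
have [g Cg' [g_le g_at]] := project_box P Cg neq_ij.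
have P1 k : P k (tnth z1 k).
  rewrite /P (forallP b1 k) /=; apply/implyP; rewrite !inE => /and3P[_ ki Kk].
  by rewrite m1 // !inE ki.
have P2 k : P k (tnth z2 k).
  rewrite /P (forallP b2 k) /=; apply/implyP; rewrite !inE => /and3P[kj _ Kk].
  by rewrite m2 // !inE kj.
have g1 : feas g [tuple tnth x i; tnth x j].
  by have := le_lt_trans (g_le _ P1) f1; rewrite z1i m1j.
have g2 : feas g [tuple tnth y i; tnth y j].
  by have := le_lt_trans (g_le _ P2) f2; rewrite m2i z2j.
have lt_g : g [tuple tnth y i; tnth x j] + g [tuple tnth x i; tnth y j] < infty.
  by apply: le_lt_trans (cxy i j Si Sj g Cg' g1 g2) _; rewrite qadd_lt_infty; apply/andP.
move: lt_g; rewrite qadd_lt_infty => /andP[/[dup] lt_g /g_at[z [Pz zi zj gE]] _].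
exists z; split; first by rewrite /feas -gE.
  by apply/forallP => k; case/andP: (Pz k).
move=> k Kk; have [->|ki] := eqVneq k i; first by rewrite zi tnth_mktuple Si.
have [->|kj] := eqVneq k j; first by rewrite zj tnth_mktuple (negbTE Sj).
by case/andP: (Pz k) => _ /implyP h; apply/eqP/h; rewrite !inE ki kj.
Qed.

Lemma feas_mix r (gamma : wrel D r) (S : pred 'I_r) x y :
  C gamma -> compatible S x y -> feas gamma x -> feas gamma y ->
  feas gamma (mix S x y).
Proof.
move=> Cg cxy fx fy; have [z [fz _ mz]] := feas_mix_on setT Cg cxy fx fy.
by rewrite (_ : mix S x y = z) //; apply: eq_from_tnth => k; rewrite mz ?inE.
Qed.

(** * The exchange inequality *)

Definition splits r (U : pred 'I_r) (x y w : r.-tuple D) : bool :=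
  [exists k, U k && (tnth w k != tnth x k)] &&
  [exists k, U k && (tnth w k != tnth y k)].

Lemma splitsN r (U : pred 'I_r) (x y w : r.-tuple D) i : ~~ splits U x y w ->
  U i -> tnth x i <> tnth y i ->
  (tnth w i = tnth x i -> forall k, U k -> tnth w k = tnth x k) /\
  (tnth w i = tnth y i -> forall k, U k -> tnth w k = tnth y k).
Proof.
rewrite negb_and !negb_exists => nsplit Ui neq_i.
case/orP: nsplit => /forallP h.
  have hU k : U k -> tnth w k = tnth x k.
    by move=> Uk; have := h k; rewrite Uk /= => /negPn/eqP.
  by split=> // wi; case: neq_i; rewrite -wi hU.
have hU k : U k -> tnth w k = tnth y k.
  by move=> Uk; have := h k; rewrite Uk /= => /negPn/eqP.
by split=> // wi; case: neq_i; rewrite -wi hU.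
Qed.

(* A feasible [w] that splits one of the two blocks yields two pairs at smaller
   distance whose inequalities add up.  If there is none, the only feasible
   points of the box are [x], [y] and their two mixes, and projecting to one
   coordinate of each block loses nothing. *)
Lemma mix_le r (gamma : wrel D r) (S : pred 'I_r) x y :
  C gamma -> compatible S x y -> feas gamma x -> feas gamma y ->
  gamma (mix S x y) + gamma (mix S y x) <= gamma x + gamma y.
Proof.
move=> Cg; move: {2}(distance x y) (leqnn (distance x y)) => n.
elim/ltn_ind: n x y => n IHn x y le_n cxy fx fy.
have IH x' y' k : subpair x' y' x y -> tnth x' k = tnth y' k ->
    tnth x k <> tnth y k -> feas gamma x' -> feas gamma y' ->
    gamma (mix S x' y') + gamma (mix S y' x') <= gamma x' + gamma y'.
  move=> sub eqk neqk; apply: (IHn (distance x' y')) => //.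
    exact: leq_trans (distance_subpair sub eqk neqk) le_n.
  exact: compatible_subpair sub cxy.
have subL w : inbox x y w -> compatible S x w.
  move=> /inboxP bw; apply: compatible_subpair cxy => k.
  by case: (bw k) => ->; [left | right].
have [/existsP[w /and3P[fw bw /andP[]]]|noS] :=
  boolP [exists w, [&& feas gamma w, inbox x y w & splits S x y w]].
  move=> /existsP[k /andP[Sk /eqP wkx]] /existsP[l /andP[Sl /eqP wly]].
  have wk : tnth w k = tnth y k by case: (inboxP bw k).
  have wl : tnth w l = tnth x l by case: (inboxP bw l).
  (* The pair [z], [y] merges at [k] and has mixes [mix S x y] and [b]; the pair [x], [b] merges at
     [l] and has mixes [z] and [mix S y x]. In the sum of both inequalities [z] and [b] cancel. *)
  pose z := mix S x w; pose b := mix S y w.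
  have fz : feas gamma z by apply: feas_mix => //; exact: subL.
  have zy_sub : subpair z y x y.
    move=> i; rewrite tnth_mktuple; case: (S i); last by right.
    by case: (inboxP bw i) => ->; [right | left].
  have xb_sub : subpair x b x y.
    move=> i; rewrite tnth_mktuple; case: (S i); last by right.
    by case: (inboxP bw i) => ->; [left | right].
  have bE : mix S y z = b.
    by apply: eq_from_tnth => i; rewrite !tnth_mktuple; case: (S i).
  have fb : feas gamma b.
    rewrite -bE; apply: feas_mix => //; apply: compatible_bar.
    exact: compatible_subpair zy_sub cxy.
  apply: (qle_add_chain fz fb).
    have := IH z y k zy_sub; rewrite bE.
    have -> : mix S z y = mix S x y.
      by apply: eq_from_tnth => i; rewrite !tnth_mktuple; case: (S i).
    by apply=> //; [rewrite tnth_mktuple Sk | rewrite -wk => /esym].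
  have := IH x b l xb_sub.
  have -> : mix S x b = z.
    by apply: eq_from_tnth => i; rewrite !tnth_mktuple; case: (S i).
  have -> : mix S b x = mix S y x.
    by apply: eq_from_tnth => i; rewrite !tnth_mktuple; case: (S i).
  by apply=> //; [rewrite tnth_mktuple Sl | rewrite -wl].
have [/existsP[w /and3P[fw bw /andP[]]]|noT] :=
  boolP [exists w, [&& feas gamma w, inbox x y w & splits (predC S) x y w]].
  move=> /existsP[k /andP[/= /negbTE Sk /eqP wkx]].
  move=> /existsP[l /andP[/= /negbTE Sl /eqP wly]].
  have wk : tnth w k = tnth y k by case: (inboxP bw k).
  have wl : tnth w l = tnth x l by case: (inboxP bw l).
  (* The same argument on the complement of [S], with the two mixes of [x] and [y] interchanged. *)
  pose z := mix S w x; pose b := mix S w y.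
  have fz : feas gamma z.
    by apply: feas_mix => //; apply: compatible_bar; exact: subL.
  have zy_sub : subpair z y x y.
    move=> i; rewrite tnth_mktuple; case: (S i); first by right.
    by case: (inboxP bw i) => ->; [right | left].
  have xb_sub : subpair x b x y.
    move=> i; rewrite tnth_mktuple; case: (S i); first by right.
    by case: (inboxP bw i) => ->; [left | right].
  have bE : mix S z y = b.
    by apply: eq_from_tnth => i; rewrite !tnth_mktuple; case: (S i).
  have fb : feas gamma b.
    by rewrite -bE; apply: feas_mix => //; exact: compatible_subpair zy_sub cxy.
  rewrite addrC; apply: (qle_add_chain fz fb).
    have := IH z y k zy_sub; rewrite bE.
    have -> : mix S y z = mix S y x.
      by apply: eq_from_tnth => i; rewrite !tnth_mktuple; case: (S i).
    rewrite addrC; apply=> //; first by rewrite tnth_mktuple Sk.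
    by rewrite -wk => /esym.
  have := IH x b l xb_sub.
  have -> : mix S x b = mix S x y.
    by apply: eq_from_tnth => i; rewrite !tnth_mktuple; case: (S i).
  have -> : mix S b x = z.
    by apply: eq_from_tnth => i; rewrite !tnth_mktuple; case: (S i).
  by rewrite addrC; apply=> //; [rewrite tnth_mktuple Sl | rewrite -wl].
case: (pickP (fun i => S i && (tnth x i != tnth y i))) => [i|eqS]; last first.
  have eqS' k : S k -> tnth x k = tnth y k.
    by move=> Sk; have := eqS k; rewrite Sk => /negbFE/eqP.
  have -> : mix S x y = x.
    by apply: eq_from_tnth => k; rewrite tnth_mktuple; case: ifP => // /eqS' ->.
  have -> // : mix S y x = y.
  by apply: eq_from_tnth => k; rewrite tnth_mktuple; case: ifP => // /eqS' ->.
case/andP=> Si /eqP neq_i.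
case: (pickP (fun j => ~~ S j && (tnth x j != tnth y j))) => [j|eqT]; last first.
  have eqT' k : S k = false -> tnth x k = tnth y k.
    by move=> Sk; have := eqT k; rewrite Sk => /negbFE/eqP.
  have -> : mix S x y = y.
    by apply: eq_from_tnth => k; rewrite tnth_mktuple; case: ifP => // /eqT' ->.
  have -> : mix S y x = x.
    by apply: eq_from_tnth => k; rewrite tnth_mktuple; case: ifP => // /eqT' ->.
  by rewrite addrC.
case/andP=> Sj /eqP neq_j.
have neq_ij : i != j by apply: contraNneq Sj => <-.
pose P k c := (c == tnth x k) || (c == tnth y k).
have [g Cg' [g_le g_at]] := project_box P Cg neq_ij.
have gx : g [tuple tnth x i; tnth x j] <= gamma x.
  by apply: g_le => k; rewrite /P eqxx.
have gy : g [tuple tnth y i; tnth y j] <= gamma y.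
  by apply: g_le => k; rewrite /P eqxx orbT.
(* Compatibility bounds the mixed corners of [g] by [gamma x + gamma y]; it remains to see that
   these corners are the values of [gamma] at the two mixes. *)
have le_g := le_trans (cxy i j Si Sj g Cg' (le_lt_trans gx fx) (le_lt_trans gy fy))
  (qleD gx gy).
apply: (le_trans _ le_g) => /=.
have : g [tuple tnth y i; tnth x j] + g [tuple tnth x i; tnth y j] < infty.
  apply: le_lt_trans le_g _; rewrite qadd_lt_infty; exact/andP.
rewrite qadd_lt_infty => /andP[/[dup] fu /g_at[u [bu ui uj uE]]].
move=> /[dup] fv /g_at[v [bv vi vj vE]].
have {}bu : inbox x y u by apply/forallP.
have {}bv : inbox x y v by apply/forallP.
have nsplit w (U : pred 'I_r) :
    ~~ [exists w, [&& feas gamma w, inbox x y w & splits U x y w]] ->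
    inbox x y w -> feas gamma w -> ~~ splits U x y w.
  by rewrite negb_exists => /forallP/(_ w) + bw fw; rewrite bw fw.
have {}fu : feas gamma u by rewrite /feas -uE.
have {}fv : feas gamma v by rewrite /feas -vE.
(* The minimisers [u] and [v] split neither block, so their values at [i] and [j] determine them on
   all coordinates. *)
have [_ uS] := splitsN (nsplit _ _ noS bu fu) Si neq_i.
have [uT _] := splitsN (nsplit _ _ noT bu fu) Sj neq_j.
have [vS _] := splitsN (nsplit _ _ noS bv fv) Si neq_i.
have [_ vT] := splitsN (nsplit _ _ noT bv fv) Sj neq_j.
have -> : mix S x y = u.
  apply: eq_from_tnth => k; rewrite tnth_mktuple; case: ifPn => Sk.
    by rewrite uS.
  by rewrite uT.
have -> : mix S y x = v.
  apply: eq_from_tnth => k; rewrite tnth_mktuple; case: ifPn => Sk.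
    by rewrite vS.
  by rewrite vT.
by rewrite uE vE.
Qed.

(** * From independent parts to the multimorphism *)

Lemma compat_bipartition (M1 M2 : {set D * D}) p q :
  bipartition (loopless Gamma) M1 M2 ->
  independent Gamma M1 -> independent Gamma M2 ->
  p \in M2 -> q \notin M2 -> compat p q.
Proof.
move=> [M_iff _] ind1 ind2 M2p M2q.
have [vp nloop_p] : loopless Gamma p by apply/M_iff; rewrite inE M2p orbT.
apply: compat_edge => _ vq edge_pq.
have barK t : bar (bar t) = t by case: t.
(* Edges are not decidable; the double negation suffices because the goal is a contradiction. *)
have loop_q : ~ ~ edge Gamma q q.
  move=> nloop_q.
  have M1q : q \in M1.
    have : q \in M1 :|: M2 by apply/M_iff.
    by rewrite inE (negbTE M2q) orbF.
  (* Reversal preserves looplessness. With [bar q] in [M1] the edge from [q] to [bar q] violates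
     independence, and in [M2] the edge from [p] to [bar q] does. *)
  have : bar q \in M1 :|: M2.
    apply/M_iff; split; first by rewrite /vertex eq_sym.
    by move/edge_bar; rewrite barK.
  rewrite inE => /orP[M1bq|M2bq].
    exact: ind1 M1q M1bq (edge_self_bar vq).
  exact: ind2 M2p M2bq edge_pq.
apply: loop_q => loop_q; apply: nloop_p.
(* The loop at [bar q] turns the edge from [p] to [bar q] into one from [p] to [q]; composed with
   the edge from [q] to [bar p], it gives a loop at [p]. *)
have edge_pq' : edge Gamma p q.
  by have := edge_comp edge_pq (edge_bar loop_q); rewrite barK.
have := edge_sym (edge_bar edge_pq); rewrite barK => edge_qp.
by have := edge_comp edge_pq' edge_qp; rewrite barK.
Qed.

End Closure.

Theorem theorem4p13 (D : finType) (Gamma : language D) (M1 M2 : {set D * D})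
  (Gamma_conservative : conservative Gamma)
  (no_soft_loop : forall p : D * D, ~ soft_edge Gamma p p)
  (M_partition : bipartition (loopless Gamma) M1 M2)
  (M1_independent : independent Gamma M1)
  (M2_independent : independent Gamma M2) :
  multimorphism
    [tuple binary_op (sqcap M1 M2); binary_op (sqcup M1 M2)] Gamma.
Proof.
move=> r gamma Ggamma xs fxs.
have Cgamma := closure_base Ggamma.
pose x := tnth xs 0; pose y := tnth xs 1.
pose S : pred 'I_r := fun i => (tnth x i, tnth y i) \in M2.
(* [meet_join] tests [M1] first; by disjointness its outcome depends on membership in [M2] alone. *)
have M12 p : p \in M1 -> (p \in M2) = false.
  by case: M_partition => _ dis M1p; apply/negbTE; rewrite (disjointFr dis M1p).
have cxy : compatible Gamma S x y.
  by move=> i j Si Sj; exact: compat_bipartition M_partition _ _ Si Sj.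
have capE : apply_op (binary_op (sqcap M1 M2)) xs = mix S x y.
  apply: eq_from_tnth => i; rewrite !tnth_mktuple /binary_op !tnth_mktuple.
  rewrite /sqcap /meet_join /S; case: ifP => [/M12->//|_].
  by case: ifP.
have cupE : apply_op (binary_op (sqcup M1 M2)) xs = mix S y x.
  apply: eq_from_tnth => i; rewrite !tnth_mktuple /binary_op !tnth_mktuple.
  rewrite /sqcup /meet_join /S; case: ifP => [/M12->//|_].
  by case: ifP.
have fx : feas gamma x by exact: fxs.
have fy : feas gamma y by exact: fxs.
split=> [i|].
  case: i => [[|[|//]] lt_i]; rewrite /tnth /= ?capE ?cupE;
    apply: (feas_mix Cgamma) => //.
  exact: compatible_bar.
rewrite !big_ord_recl !big_ord0 /= !addr0.
rewrite [tnth _ ord0]/= [tnth _ (lift _ _)]/= capE cupE.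
rewrite (_ : lift ord0 ord0 = 1 :> 'I_2); last exact: val_inj.
exact: (mix_le Cgamma).
Qed.
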